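(* (i) The functional $\sigma:S\to\mathbb{R}$, $\sigma(f)=\min A(f)$, is $\mathcal{C}_S$-Borel measurable and lower semicontinuous with respect to the topology $\mathcal{T}_S$. (ii) The functional $\tau:S'\to\mathbb{R}$, $\tau(f)=\max A(f)$, is $\mathcal{C}_{S'}$-Borel measurable and upper semicontinuous with respect to the topology $\mathcal{T}_{S'}$.
   Context: $C$ is the set of all convex functions $f:\mathbb{R}\to\mathbb{R}$; $A(f)=\{t\in\mathbb{R}: f(t)=\inf_{s\in\mathbb{R}} f(s)\}$. $S=\{f\in C: A(f)\neq\emptyset,\ \inf A(f)>-\infty\}$ and $S'=\{f\in C: A(f)\ne\emptyset,\ \sup A(f)<\infty\}$, i.e. the convex functions having a smallest, respectively largest, minimizer. For $t\in\mathbb{R}$, $\pi_t:C\to\mathbb{R}$, $\pi_t(f)=f(t)$. $\mathcal{C}=\sigma(\pi_t:t\in\mathbb{R})$ is the $\sigma$-algebra on $C$ generated by all $\pi_t$, and $\mathcal{T}$ is the topology of pointwise convergence on $C$, i.e. the smallest topology making all $\pi_t$ continuous. For $U\subseteq C$, $\mathcal{C}_U=U\cap\mathcal{C}$ is the trace $\sigma$-algebra and $\mathcal{T}_U=U\cap\mathcal{T}$ the subspace topology. A real function $g$ on a topological space is lower (upper) semicontinuous if $\{g\le x\}$ (respectively $\{g\ge x\}$) is closed for every $x\in\mathbb{R}$. *)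

(* Defs.v *)
From HB Require Import structures.
From mathcomp Require Import all_boot all_order all_algebra.
From mathcomp Require Import all_classical all_reals all_analysis.
From mathcomp Require Import ring lra.
Set Implicit Arguments.
Unset Strict Implicit.
Unset Printing Implicit Defensive.
Import Order.TTheory GRing.Theory Num.Theory.
Import numFieldNormedType.Exports.
Local Open Scope classical_set_scope.
Local Open Scope ring_scope.

Section convex_functions.
Variable R : realType.

Definition cvx_set : set (R -> R) :=
  [set f | convex_function [set: convex_lmodType R^o] f].

(* The space C of all convex functions on the line.  [R -> R] carries no
   canonical topology or sigma-algebra, hence neither does [set_type cvx_set];
   both structures are put on C below, from the evaluations [ev t]. *)
Definition cvx : Type := cvx_set.

Definition ev (t : R) (f : cvx) : R := set_val f t.

HB.instance Definition _ := Choice.on cvx.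

(* [sup_topology] takes the open sets of all the [initial_topology (ev t)] as a
   subbase: this is the smallest topology making every [ev t] continuous. *)
HB.instance Definition _ := Topological.copy cvx
  (sup_topology (fun t : R => Topological.on (initial_topology (ev t)))).

Lemma normr_cvx : cvx_set (fun x : R => `|x|).
Proof.
move=> t x y _ _.
change (`|t%:num * x + (1 - t%:num) * y| <=
        t%:num * `|x| + (1 - t%:num) * `|y|).
have t1 : 0 <= 1 - t%:num by rewrite subr_ge0.
apply: le_trans (ler_normD _ _) _.
by rewrite !normrM (ger0_norm t1) ger0_norm.
Qed.

Definition normr_C : cvx := exist _ (fun x : R => `|x|) (mem_set normr_cvx).

(* Library measurable types are pointed. *)
HB.instance Definition _ := isPointed.Build cvx normr_C.

Definition ev_system : set (set cvx) :=
  \bigcup_t preimage_set_system [set: cvx] (ev t) (@measurable _ R).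

HB.instance Definition _ := Measurable.copy cvx (g_sigma_algebraType ev_system).

(* The infimum is taken in the extended reals: the real-valued [inf] returns a
   default value on sets that are not bounded below. *)
Definition argmin (f : cvx) : set R :=
  [set t | (ev t f)%:E = ereal_inf [set (ev s f)%:E | s in [set: R]]].

Definition Smin_set : set cvx :=
  [set f | argmin f !=set0 /\
           (-oo < ereal_inf [set t%:E | t in argmin f])%E].

Definition Smax_set : set cvx :=
  [set f | argmin f !=set0 /\
           (ereal_sup [set t%:E | t in argmin f] < +oo)%E].

(* S and S' *)
Definition Smin : Type := Smin_set.
Definition Smax : Type := Smax_set.

(* [set_type] of a topological space carries the subspace topology. *)
HB.instance Definition _ := Topological.copy Smin (set_type Smin_set).
HB.instance Definition _ := Topological.copy Smax (set_type Smax_set).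

Definition Smin_val (f : Smin) : cvx := set_val f.
Definition Smax_val (f : Smax) : cvx := set_val f.

Lemma argminE (f : cvx) t : argmin f t <-> forall s, ev t f <= ev s f.
Proof.
split=> [ft s|ft].
  by rewrite -lee_fin ft; apply: ereal_inf_lbound; exists s.
apply/eqP; rewrite eq_le; apply/andP; split.
  by apply: le_ereal_inf_tmp => _ [s _ <-]; rewrite lee_fin.
by apply: ereal_inf_lbound; exists t.
Qed.

Lemma argmin_normr : argmin normr_C = [set 0].
Proof.
apply/seteqP; split=> [t /argminE /(_ 0)|_ -> ].
  by rewrite /ev /= set_valE /= normr0 normr_le0 => /eqP.
by apply/argminE => s; rewrite /ev set_valE /= normr0.
Qed.

Lemma normr_Smin : Smin_set normr_C.
Proof.
rewrite /Smin_set /= argmin_normr; split; first by exists 0.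
by rewrite image_set1 ereal_inf1 ltNyr.
Qed.

Lemma normr_Smax : Smax_set normr_C.
Proof.
rewrite /Smax_set /= argmin_normr; split; first by exists 0.
by rewrite image_set1 ereal_sup1 ltry.
Qed.

HB.instance Definition _ :=
  isPointed.Build Smin (exist _ normr_C (mem_set normr_Smin)).
HB.instance Definition _ :=
  isPointed.Build Smax (exist _ normr_C (mem_set normr_Smax)).

(* The trace of a sigma-algebra on a subset is its preimage under the
   inclusion of that subset. *)
HB.instance Definition _ :=
  Measurable.copy Smin (g_sigma_algebra_preimageType Smin_val).
HB.instance Definition _ :=
  Measurable.copy Smax (g_sigma_algebra_preimageType Smax_val).

Definition is_min (A : set R) (m : R) := A m /\ lbound A m.
Definition is_max (A : set R) (m : R) := A m /\ ubound A m.

(* The default value 0 of [xget] is never used, by [sigmaP] and [tauP]. *)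
Definition sigma (f : Smin) : R := xget 0 (is_min (argmin (Smin_val f))).
Definition tau (f : Smax) : R := xget 0 (is_max (argmin (Smax_val f))).

Lemma cvx_ineq (f : cvx) (x y l : R) : 0 <= l <= 1 ->
  ev (l * x + (1 - l) * y) f <= l * ev x f + (1 - l) * ev y f.
Proof.
move=> /andP[l0 l1]; case: f => f /=; rewrite /ev set_valE /= => fC.
have := set_mem fC; have l01 : 0 <= l <= 1 by rewrite l0.
pose t := Itv01 l0 l1.
by move=> /(_ t x y); rewrite !inE => /(_ I I).
Qed.

Lemma argmin_adherent (f : cvx) (m : R) :
  (forall e, 0 < e -> exists2 a, argmin f a & `|a - m| < e) -> argmin f m.
Proof.
move=> adh; have [a0 /argminE fa0 _] := adh 1 ltr01.
pose c := ev a0 f.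
suff : ev m f <= c.
  by move=> fm; apply/argminE => s; exact: le_trans (fa0 s).
rewrite leNgt; apply/negP => cm; pose d := ev m f - c.
have d0 : 0 < d by rewrite subr_gt0.
pose B := Num.max (ev (m - 1) f) (ev (m + 1) f) - c.
have B0 : 0 <= B by rewrite subr_ge0 le_max fa0.
have [a /argminE fa am] := adh (d / (B + 1)) ltac:(by rewrite divr_gt0// ltr_wpDl).
have fac : ev a f = c by apply/eqP; rewrite eq_le fa fa0.
pose h := `|a - m|; have h0 : 0 <= h by rewrite normr_ge0.
have h1 : 1 + h != 0 by rewrite gt_eqF// ltr_wpDr.
pose l := h / (1 + h).
have l0 : 0 <= l by rewrite divr_ge0// addr_ge0.
have l1 : l <= 1 by rewrite ler_pdivrMr ?mul1r ?lerDr// ltr_wpDr.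
have lh : l <= h by rewrite ler_pdivrMr ?ltr_wpDr// mulrDr mulr1 lerDl mulr_ge0.
suff dlB : d <= l * B.
  have : h * (B + 1) < d by rewrite -ltr_pdivlMr// ltr_wpDl.
  have := ler_wpM2r B0 lh; nra.
have key y : m = l * y + (1 - l) * a -> ev y f <= B + c -> d <= l * B.
  move=> my yB; have l01 : 0 <= l <= 1 by rewrite l0.
  have := @cvx_ineq f y a l l01; rewrite -my fac /d.
  have := ler_wpM2l l0 yB; nra.
have [le|lt] := leP m a.
- apply: (key (m - 1)); last by rewrite /B subrK le_max lexx.
  have ha : a = m + h by rewrite /h ger0_norm ?subr_ge0// addrC subrK.
  by rewrite ha /l; field.
- apply: (key (m + 1)); last by rewrite /B subrK le_max lexx orbT.
  have ha : a = m - h by rewrite /h ltr0_norm ?subr_lt0//; ring.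
  by rewrite ha /l; field.
Qed.

Lemma sigmaP (f : Smin) : is_min (argmin (Smin_val f)) (sigma f).
Proof.
rewrite /sigma; case: xgetP => [//|no]; exfalso.
have [A0 Ainf] : Smin_set (Smin_val f) by exact: set_valP.
pose A := argmin (Smin_val f).
have Alb : has_lbound A.
  move: Ainf; case E : ereal_inf => [r| |] // _; last first.
    case: A0 => a Aa; have : (ereal_inf [set t%:E | t in A] <= a%:E)%E.
      by apply: ereal_inf_lbound; exists a.
    by rewrite E.
  exists r => a Aa; rewrite -lee_fin -E.
  by apply: ereal_inf_lbound; exists a.
apply: (no (inf A)); split; last by move=> a Aa; exact: ge_inf.
apply: argmin_adherent => e e0.
have [a Aa ae] := inf_adherent e0 (conj A0 Alb); exists a => //.
by rewrite ger0_norm ?subr_ge0 ?ltrBlDl//; exact: ge_inf.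
Qed.

Lemma tauP (f : Smax) : is_max (argmin (Smax_val f)) (tau f).
Proof.
rewrite /tau; case: xgetP => [//|no]; exfalso.
have [A0 Asup] : Smax_set (Smax_val f) by exact: set_valP.
pose A := argmin (Smax_val f).
have Aub : has_ubound A.
  move: Asup; case E : ereal_sup => [r| |] // _; last first.
    case: A0 => a Aa; have : (a%:E <= ereal_sup [set t%:E | t in A])%E.
      by apply: ereal_sup_ubound; exists a.
    by rewrite E.
  exists r => a Aa; rewrite -lee_fin -E.
  by apply: ereal_sup_ubound; exists a.
apply: (no (sup A)); split; last by move=> a Aa; exact: ub_le_sup.
apply: argmin_adherent => e e0.
have [a Aa ae] := sup_adherent e0 (conj A0 Aub); exists a => //.
rewrite ler0_norm ?subr_le0; last exact: ub_le_sup.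
by rewrite opprB ltrBlDr -ltrBlDl.
Qed.

End convex_functions.

(* The library's [lower_semicontinuous] is for extended-real-valued functions,
   and it has no upper counterpart. *)
Definition real_lsc (R : realType) (X : topologicalType) (g : X -> R) :=
  forall x : R, closed [set u | g u <= x].

Definition real_usc (R : realType) (X : topologicalType) (g : X -> R) :=
  forall x : R, closed [set u | x <= g u].

(* Main.v *)
Require Import Defs.
From mathcomp Require Import all_boot all_order all_algebra.
From mathcomp Require Import all_classical all_reals all_analysis.
From mathcomp Require Import measurable_realfun.
From mathcomp Require Import ring lra.
Set Implicit Arguments.
Unset Strict Implicit.
Unset Printing Implicit Defensive.
Import Order.TTheory GRing.Theory Num.Theory.
Import numFieldNormedType.Exports.
Local Open Scope classical_set_scope.
Local Open Scope ring_scope.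

(** A convex function does not decrease as one moves away from a minimizer [m],
    and it strictly increases once the set of minimizers has been left.  Hence,
    if [m] is the smallest minimizer of [f], then [x < m] holds if and only if
    some [q > x] satisfies [f q < f x]: when [x < m], every [q] strictly between
    [x] and [m] will do, because [f x] is not minimal; when [m <= x < q],
    monotonicity on the right of [m] forbids it.  Since the whole interval
    between [x] and [m] is available, [q] can be taken rational without any
    appeal to the continuity of convex functions ([argmin_gtP]).

    Therefore [{sigma > x}] is the countable union, over the rationals [q > x],
    of the sets [{f | f q < f x}].  Each of them compares two evaluations, so it
    is both open and measurable, and then so is the union; this gives lower
    semicontinuity and measurability at the same time.  The argument for [tau]
    is its mirror image ([argmin_ltP]), with [q < x]. *)

(** * Convex functions away from a minimizer *)

Section away_from_minimizer.
Variable R : realType.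
Implicit Types (f : cvx R) (m a b x : R).

Definition between m a b := (m <= a <= b) || (b <= a <= m).

(** Stated for both positions of [b] relative to [m], so that one argument
    serves smallest and largest minimizers. *)
Lemma between_conv_comb m a b : between m a b ->
  exists2 l, 0 <= l <= 1 & a = l * m + (1 - l) * b /\ (a != b -> l != 0).
Proof.
move=> mab; have [bm|bm] := eqVneq b m.
  exists 1; first by rewrite ler01 lexx.
  split; last by move=> _; exact: oner_neq0.
  rewrite mul1r subrr mul0r addr0; apply/eqP; rewrite eq_le.
  by move: mab; rewrite /between bm => /orP[] /andP[-> ->].
have mb0 : m - b != 0 by rewrite subr_eq0 eq_sym.
exists ((a - b) / (m - b)); last first.
  split; first by field.
  by move=> ab; rewrite mulf_eq0 invr_eq0 (negPf mb0) orbF subr_eq0.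
case/orP: mab => /andP[ma ab].
  have mb : m < b by rewrite lt_neqAle eq_sym bm (le_trans ma).
  rewrite -mulrNN -invrN !opprB divr_ge0 ?subr_ge0 ?(ltW mb)//=.
  by rewrite ler_pdivrMr ?subr_gt0// mul1r; lra.
have mb : b < m by rewrite lt_neqAle bm (le_trans ma).
rewrite divr_ge0 ?subr_ge0 ?(ltW mb)//=.
by rewrite ler_pdivrMr ?subr_gt0// mul1r; lra.
Qed.

Lemma le_ev_away f m a b :
  argmin f m -> between m a b -> ev a f <= ev b f.
Proof.
move=> /argminE/(_ b) mb /between_conv_comb[l l01 [-> _]].
apply: le_trans (cvx_ineq f m b l01) _.
by case/andP: l01 => l0 _; have := ler_wpM2l l0 mb; lra.
Qed.

(** Here [b] is not minimal, so [f m < f b]; a convex combination of these two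
    values that gives [m] a positive weight is below [f b]. *)
Lemma lt_ev_away f m a b : argmin f m -> ~ argmin f b ->
  between m a b -> a != b -> ev a f < ev b f.
Proof.
move=> /argminE fm fb /between_conv_comb[l l01 [-> l_neq0]] ab.
have mb : ev m f < ev b f.
  rewrite ltNge; apply/negP => bm; apply: fb; apply/argminE => s.
  exact: le_trans bm (fm s).
apply: le_lt_trans (cvx_ineq f m b l01) _.
have l0 : 0 < l by rewrite lt_neqAle eq_sym l_neq0//; case/andP: l01.
by move: mb; rewrite -(ltr_pM2l l0); lra.
Qed.

(** The right-hand side involves the values of [f] only through comparisons of
    two evaluations, and only countably many of them. *)
Lemma argmin_gtP f m x : is_min (argmin f) m ->
  x < m <-> exists2 q : rat, x < ratr q & ev (ratr q) f < ev x f.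
Proof.
move=> [fm lbm]; split=> [xm|[q xq]].
  have [q] := rat_in_itvoo xm; rewrite in_itv => /andP[xq qm]; exists q => //.
  apply: (lt_ev_away fm).
  - by move=> /lbm; rewrite leNgt xm.
  - by rewrite /between (ltW xq) (ltW qm) orbT.
  - by rewrite gt_eqF.
apply: contraTT; rewrite -!leNgt => mx; apply: (le_ev_away fm).
by rewrite /between mx (ltW xq).
Qed.

Lemma argmin_ltP f m x : is_max (argmin f) m ->
  m < x <-> exists2 q : rat, ratr q < x & ev (ratr q) f < ev x f.
Proof.
move=> [fm ubm]; split=> [mx|[q qx]].
  have [q] := rat_in_itvoo mx; rewrite in_itv => /andP[mq qx]; exists q => //.
  apply: (lt_ev_away fm).
  - by move=> /ubm; rewrite leNgt mx.
  - by rewrite /between (ltW mq) (ltW qx).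
  - by rewrite lt_eqF.
apply: contraTT; rewrite -!leNgt => xm; apply: (le_ev_away fm).
by rewrite /between xm (ltW qx) orbT.
Qed.

End away_from_minimizer.

(** * Comparisons of two evaluations *)

Section comparisons.
Variable R : realType.

(** A filter converges in a supremum topology exactly when it converges in each
    of the topologies of the family. *)
Lemma continuous_ev (t : R) : continuous (@ev R t).
Proof.
move=> f; have /cvg_sup/(_ t) ft : nbhs f --> f by [].
exact: cvg_comp ft (@initial_continuous (cvx R) R (ev t) f).
Qed.

Lemma measurable_ev (t : R) : measurable_fun [set: cvx R] (ev t).
Proof. by move=> _ B mB; apply: sub_sigma_algebra; exists t => //; exists B. Qed.

Lemma open_lt_ev (X : topologicalType) (v : X -> cvx R) (s t : R) :
  continuous v -> open [set u | ev s (v u) < ev t (v u)].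
Proof.
move=> cv.
rewrite [X in open X](_ : _ =
  (fun u => ev t (v u) - ev s (v u)) @^-1` [set y | 0 < y]); last first.
  by apply/seteqP; split=> u /=; rewrite subr_gt0.
apply: open_comp; last exact: open_gt.
move=> u _; apply: cvgB;
  by apply: continuous_comp (cv u) _; exact: continuous_ev.
Qed.

Lemma measurable_lt_ev d (X : measurableType d) (v : X -> cvx R) (s t : R) :
  measurable_fun setT v -> measurable [set u | ev s (v u) < ev t (v u)].
Proof.
move=> mv.
have mev r : measurable_fun setT (fun u => ev r (v u)).
  exact: measurableT_comp (measurable_ev r) mv.
rewrite -[X in measurable X]setTI.
exact: (measurable_fun_ltr (mev s) (mev t) measurableT (Y := [set true])).
Qed.

Lemma continuous_Smin_val : continuous (@Smin_val R).
Proof. exact: initial_continuous. Qed.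

Lemma continuous_Smax_val : continuous (@Smax_val R).
Proof. exact: initial_continuous. Qed.

Lemma measurable_Smin_val : measurable_fun [set: Smin R] (@Smin_val R).
Proof. by move=> _ B mB; exists B. Qed.

Lemma measurable_Smax_val : measurable_fun [set: Smax R] (@Smax_val R).
Proof. by move=> _ B mB; exists B. Qed.

End comparisons.

(** * Rays of the smallest and of the largest minimizer *)

Section rays.
Variable R : realType.

Lemma sigma_gtE (x : R) : [set u | x < sigma u] =
  \bigcup_(q in [set q : rat | x < ratr q])
    [set u | ev (ratr q) (Smin_val u) < ev x (Smin_val u)].
Proof.
apply/seteqP; split=> u /=.
  by move=> /(argmin_gtP _ (sigmaP u))[q]; exists q.
by move=> [q xq qx]; apply/(argmin_gtP _ (sigmaP u)); exists q.
Qed.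

Lemma tau_ltE (x : R) : [set u | tau u < x] =
  \bigcup_(q in [set q : rat | ratr q < x])
    [set u | ev (ratr q) (Smax_val u) < ev x (Smax_val u)].
Proof.
apply/seteqP; split=> u /=.
  by move=> /(argmin_ltP _ (tauP u))[q]; exists q.
by move=> [q xq qx]; apply/(argmin_ltP _ (tauP u)); exists q.
Qed.

Lemma measurable_bigcup_rat d (X : measurableType d) (D : set rat)
    (F : rat -> set X) :
  (forall q, measurable (F q)) -> measurable (\bigcup_(q in D) F q).
Proof.
move=> mF; rewrite bigcup_mkcond; apply: bigcupT_measurable_rat => q.
by case: ifPn.
Qed.

Lemma measurable_sigma : measurable_fun [set: Smin R] (@sigma R).
Proof.
apply: (measurability _ (RGenOInfty.measurableE R)) => _ [_ [x ->] <-].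
rewrite setTI preimage_itvoy sigma_gtE; apply: measurable_bigcup_rat => q.
exact/measurable_lt_ev/measurable_Smin_val.
Qed.

Lemma measurable_tau : measurable_fun [set: Smax R] (@tau R).
Proof.
apply: (measurability _ (RGenInftyO.measurableE R)) => _ [_ [x ->] <-].
rewrite setTI preimage_itvNyo tau_ltE; apply: measurable_bigcup_rat => q.
exact/measurable_lt_ev/measurable_Smax_val.
Qed.

Lemma lsc_sigma : real_lsc (@sigma R).
Proof.
move=> x; rewrite [X in closed X](_ : _ = ~` [set u | x < sigma u]).
  rewrite closedC sigma_gtE; apply: bigcup_open => q _.
  exact/open_lt_ev/continuous_Smin_val.
by apply/seteqP; split=> u /=; rewrite leNgt => /negP.
Qed.

Lemma usc_tau : real_usc (@tau R).
Proof.
move=> x; rewrite [X in closed X](_ : _ = ~` [set u | tau u < x]).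
  rewrite closedC tau_ltE; apply: bigcup_open => q _.
  exact/open_lt_ev/continuous_Smax_val.
by apply/seteqP; split=> u /=; rewrite leNgt => /negP.
Qed.

End rays.

Theorem proposition2 (R : realType) :
  (measurable_fun [set: Smin R] (@sigma R) /\ real_lsc (@sigma R)) /\
  (measurable_fun [set: Smax R] (@tau R) /\ real_usc (@tau R)).
Proof.
split; split.
- exact: measurable_sigma.
- exact: lsc_sigma.
- exact: measurable_tau.
- exact: usc_tau.
Qed.
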